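(* Over the identity $X_*(\mathbf{T})=X^*(\widehat{\mathbf{T}})$, the $\mathbb{Z}[\mathbf{q}]$-linear map $$\mathscr{B}(\mathbf{q}):\mathcal{A}(\mathbf{q})\longrightarrow\mathbb{Z}[V_{\widehat{\mathbf{T}}\subset\widehat{\mathbf{G}},\rho_{\mathrm{ad}}}],\qquad E(\nu)\longmapsto(e_1^{\nu}\otimes e_2^{-\nu_-})|_{\rho_{\mathrm{ad}}}$$ is an isomorphism of $\mathbb{Z}[\mathbf{q}]$-algebras.
   Context: **Dual side.** $\widehat{\mathbf{G}}$ is a split connected reductive group scheme over $\mathbb{Z}$, $\widehat{\mathbf{T}}\subset\widehat{\mathbf{B}}\subset\widehat{\mathbf{G}}$ a split maximal torus and a Borel subgroup, $W$ the Weyl group, $\widehat{\mathbf{T}}_{\mathrm{ad}}=\widehat{\mathbf{T}}/Z_{\widehat{\mathbf{G}}}$; $X^*(\widehat{\mathbf{T}}_{\mathrm{ad}})\subset X^*(\widehat{\mathbf{T}})$ is the root lattice and $X^*(\widehat{\mathbf{T}}_{\mathrm{ad}})_{\mathrm{pos}}$ its submonoid generated by the positive roots. For $\nu\in X^*(\widehat{\mathbf{T}})$, $\nu_-$ is the unique antidominant $W$-conjugate of $\nu$. $V_{\widehat{\mathbf{T}}\subset\widehat{\mathbf{G}}}$ is the toral submonoid of the Vinberg monoid of $\widehat{\mathbf{G}}$ (closure of $(\widehat{\mathbf{T}}\times\widehat{\mathbf{T}})/Z_{\widehat{\mathbf{G}}}$); explicitly its ring of functions is the subring of $\mathbb{Z}[\widehat{\mathbf{T}}]\otimes\mathbb{Z}[\widehat{\mathbf{T}}]$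 given by $$\mathbb{Z}[V_{\widehat{\mathbf{T}}\subset\widehat{\mathbf{G}}}]=\bigoplus_{\nu_1,\nu_2\in X^*(\widehat{\mathbf{T}}),\ \nu_2+(\nu_1)_-\in X^*(\widehat{\mathbf{T}}_{\mathrm{ad}})_{\mathrm{pos}}}\mathbb{Z}\,(e_1^{\nu_1}\otimes e_2^{\nu_2}).$$ It is an algebra over $\mathbb{Z}[X^*(\widehat{\mathbf{T}}_{\mathrm{ad}})_{\mathrm{pos}}]$ via $\bar e^{\mu}\mapsto1\otimes e_2^{\mu}$. $\rho_{\mathrm{ad}}$ is the sum of the fundamental coweights of the adjoint group of $\widehat{\mathbf{G}}$, and $V_{\widehat{\mathbf{T}}\subset\widehat{\mathbf{G}},\rho_{\mathrm{ad}}}$ is the base change to $\mathbb{A}^1=\mathrm{Spec}\,\mathbb{Z}[\mathbf{q}]$ along $\mathbb{Z}[X^*(\widehat{\mathbf{T}}_{\mathrm{ad}})_{\mathrm{pos}}]\to\mathbb{Z}[\mathbf{q}]$, $\bar e^{\mu}\mapsto\mathbf{q}^{\langle\mu,\rho_{\mathrm{ad}}\rangle}$. The image of $e_1^{\nu_1}\otimes e_2^{\nu_2}$ in $\mathbb{Z}[V_{\widehat{\mathbf{T}}\subset\widehat{\mathbf{G}},\rho_{\mathrm{ad}}}]$ is written $(e_1^{\nu_1}\otimes e_2^{\nu_2})|_{\rho_{\mathrm{ad}}}$. **Hecke side.** $\mathbf{T}\subset\mathbf{G}$ are the groups dual to $\widehat{\mathbf{T}}\subset\widehat{\mathbf{G}}$,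 $F/\mathbb{Q}_p$ is a finite extension, $\mathbf{N}$ is the normalizer of $\mathbf{T}$ in $\mathbf{G}$, $\widetilde W=\mathbf{N}(F)/\mathbf{T}(o_F)$ is the extended affine Weyl group with length function $\ell$ (on $X_*(\mathbf{T})\subset\widetilde W$, $\nu\mapsto e^\nu$: $\ell(\nu)=\sum_{\alpha>0}|\langle\alpha,\nu\rangle|$) and simple affine reflections $S_{\mathrm{aff}}$. $\mathcal{H}(\mathbf{q})$ is the generic Iwahori Hecke algebra: the free $\mathbb{Z}[\mathbf{q}]$-module on $T_w$, $w\in\widetilde W$, with $T_wT_{w'}=T_{ww'}$ if $\ell(w)+\ell(w')=\ell(ww')$ and $T_s^2=\mathbf{q}+(\mathbf{q}-1)T_s$ for $s\in S_{\mathrm{aff}}$. Vignéras constructed a Bernstein basis $(E(w))_{w\in\widetilde W}$ of $\mathcal{H}(\mathbf{q})$ over $\mathbb{Z}[\mathbf{q}]$ (associated with the antidominant orientation) satisfying $E(e^\nu)E(w)=\mathbf{q}^{(\ell(\nu)+\ell(w)-\ell(e^\nu w))/2}E(e^\nu w)$ for $\nu\in X_*(\mathbf{T})$, $w\in\widetilde W$. Write $E(\nu)=E(e^\nu)$ and let $\mathcal{A}(\mathbf{q})=\bigoplus_{\nu\in X_*(\mathbf{T})}\mathbb{Z}[\mathbf{q}]E(\nu)\subset\mathcal{H}(\mathbf{q})$, a commutative subalgebra. *)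

(* Defs.v *)
From HB Require Import structures.
From mathcomp Require Import all_boot all_order all_algebra.
From mathcomp Require Import finmap monalg.
From mathcomp Require Import boolp classical_sets.
From mathcomp Require Import zify ring lra.

Set Implicit Arguments.
Unset Strict Implicit.
Unset Printing Implicit Defensive.

Import Order.TTheory GRing.Theory Num.Theory.
Local Open Scope ring_scope.

(* multinomials' product on [malg] requires a monoid without units, so the
   group ring of a lattice needs its own convolution product. *)
Definition monring (M : nmodType) := {malg int[M]}.

HB.instance Definition _ (M : nmodType) := GRing.Zmodule.on (monring M).

Definition mexp (M : nmodType) (k : M) : monring M := mkmalgU k 1.

Section MonRing.
Variable M : nmodType.
Implicit Types (g h : monring M) (k l : M).

Definition mr_mul g h : monring M :=
  \sum_(k <- msupp g) \sum_(l <- msupp h) mkmalgU (k + l)%R (mcoeff k g * mcoeff l h).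

Local Open Scope fset_scope.

Lemma mr_mulw (d1 d2 : {fset M}) g h :
  msupp g `<=` d1 -> msupp h `<=` d2 ->
  mr_mul g h =
    \sum_(k <- d1) \sum_(l <- d2) mkmalgU (k + l)%R (mcoeff k g * mcoeff l h).
Proof.
move=> le1 le2; rewrite /mr_mul (big_fset_incl _ le1) /=.
  apply: eq_bigr => k _; apply: big_fset_incl => // l _ /mcoeff_outdom ->.
  by rewrite mulr0 monalgU0.
move=> k _ /mcoeff_outdom gk; rewrite big1 // => l _.
by rewrite gk mul0r monalgU0.
Qed.

Lemma mr_mulC : commutative mr_mul.
Proof.
move=> g h; rewrite /mr_mul exchange_big /=.
by apply: eq_bigr => k _; apply: eq_bigr => l _; rewrite addrC mulrC.
Qed.

Lemma mr_mulDl : left_distributive mr_mul +%R.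
Proof.
move=> g1 g2 h.
rewrite (@mr_mulw (msupp g1 `|` msupp g2) (msupp h)) ?msuppD_le ?fsubset_refl //.
rewrite (@mr_mulw (msupp g1 `|` msupp g2) (msupp h) g1) ?fsubsetUl ?fsubset_refl //.
rewrite (@mr_mulw (msupp g1 `|` msupp g2) (msupp h) g2) ?fsubsetUr ?fsubset_refl //.
rewrite -big_split; apply: eq_bigr => k _; rewrite -big_split; apply: eq_bigr => l _.
by rewrite /= (mcoeffD k g1 g2) mulrDl monalgUD.
Qed.

Lemma mr_mulDr : right_distributive mr_mul +%R.
Proof.
by move=> g h1 h2; rewrite mr_mulC mr_mulDl (mr_mulC h1) (mr_mulC h2).
Qed.

Lemma mr_mul0 h : mr_mul 0 h = 0.
Proof. by rewrite /mr_mul msupp0 big_seq_fset0. Qed.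

Lemma mr_mulUU k l (a b : int) :
  mr_mul (mkmalgU k a) (mkmalgU l b) = mkmalgU (k + l)%R (a * b).
Proof.
by rewrite (mr_mulw msuppU_le msuppU_le) !big_seq_fset1 !mcoeffUU.
Qed.

Lemma mr_mul_suml (I : Type) (r : seq I) (F : I -> monring M) h :
  mr_mul (\sum_(i <- r) F i) h = \sum_(i <- r) mr_mul (F i) h.
Proof.
exact: (big_morph (mr_mul^~ h) (fun _ _ => mr_mulDl _ _ _) (mr_mul0 h)).
Qed.

Lemma mr_mul_sumr (I : Type) (r : seq I) (F : I -> monring M) g :
  mr_mul g (\sum_(i <- r) F i) = \sum_(i <- r) mr_mul g (F i).
Proof.
rewrite mr_mulC mr_mul_suml.
by apply: eq_bigr => i _; apply: mr_mulC.
Qed.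

Lemma mrE g : g = \sum_(k <- msupp g) (mkmalgU k (mcoeff k g) : monring M).
Proof. exact: monalgE. Qed.

Lemma mr_mulA : associative mr_mul.
Proof.
move=> g1 g2 g3; rewrite (mrE g1) !mr_mul_suml; apply: eq_bigr => k1 _.
rewrite (mrE g2) !(mr_mul_suml, mr_mul_sumr); apply: eq_bigr => k2 _.
rewrite (mrE g3) !mr_mul_sumr; apply: eq_bigr => k3 _.
by rewrite !mr_mulUU mulrA addrA.
Qed.

Lemma mr_mul1 : left_id (mexp 0 : monring M) mr_mul.
Proof.
move=> g; rewrite [in LHS](mrE g) [RHS](mrE g) mr_mul_sumr.
by apply: eq_bigr => k _; rewrite mr_mulUU mul1r add0r.
Qed.

Lemma mr_one_neq0 : mexp 0 != 0 :> monring M.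
Proof. by rewrite /mexp (monalgU_eq0 1 (0 : M)) oner_eq0. Qed.

HB.instance Definition _ := GRing.Zmodule_isComNzRing.Build (monring M)
  mr_mulA mr_mulC mr_mul1 mr_mulDl mr_one_neq0.

Lemma mexp0 : mexp 0 = 1 :> monring M. Proof. by []. Qed.

Lemma mexpD k l : mexp (k + l) = mexp k * mexp l :> monring M.
Proof. by rewrite [RHS]mr_mulUU mulr1. Qed.

Lemma monringE g : g = \sum_(k <- msupp g) mexp k *~ mcoeff k g.
Proof.
rewrite [LHS]mrE; apply: eq_bigr => k _.
by apply/malgP => l; rewrite -!(raddfMz (mkmalgU k)) /= mulrzz mul1r.
Qed.

Variable S : addrClosed M.

Definition supported_in : {pred monring M} := fun g => all [in S] (msupp g).

Lemma supported_inP g :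
  reflect (forall k, mcoeff k g != 0 -> k \in S) (g \in supported_in).
Proof.
apply: (iffP allP) => H k; first by rewrite mcoeff_neq0 => /H.
by move=> kg; apply: H; rewrite mcoeff_neq0.
Qed.

Lemma supported_mexp k : k \in S -> mexp k \in supported_in.
Proof.
move=> kS; apply/supported_inP => l; rewrite /mexp mcoeffU.
by case: (eqVneq k l) => [<-|_]; rewrite ?eqxx.
Qed.

Lemma supported_in_subring : subring_closed supported_in.
Proof.
split.
- by rewrite -mexp0 supported_mexp // rpred0.
- move=> g h /supported_inP gS /supported_inP hS; apply/supported_inP => k.
  rewrite (mcoeffB k g h); case: (eqVneq (mcoeff k g) 0) => [->|/gS //].
  by rewrite sub0r oppr_eq0 => /hS.
- move=> g h /supported_inP gS /supported_inP hS; apply/supported_inP => k.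
  apply: contraNT => kS; rewrite (_ : g * h = mr_mul g h) // /mr_mul raddf_sum /= big_seq big1 // => k1 k1g.
  rewrite raddf_sum /= big_seq big1 // => k2 k2h; rewrite mcoeffU.
  case: eqP => // e; case/negP: kS.
  by rewrite -e; apply: rpredD; [apply: gS | apply: hS]; rewrite mcoeff_neq0.
Qed.

(* The subring of Z[M] with Z-basis the e^k, k in S. *)
Record monsubring := MonSubring {
  ms_val : monring M;
  _ : ms_val \in supported_in }.

End MonRing.

HB.instance Definition _ (M : nmodType) (S : addrClosed M) :=
  [isSub for @ms_val M S].
HB.instance Definition _ (M : nmodType) (S : addrClosed M) :=
  [Choice of monsubring S by <:].
HB.instance Definition _ (M : nmodType) (S : addrClosed M) :=
  GRing.SubChoice_isSubComNzRing.Build (monring M) (supported_in S)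
    (monsubring S) (supported_in_subring S).

(* e^k as an element of the subring, for k in S; junk value 0 otherwise. *)
Definition mse (M : nmodType) (S : addrClosed M) (k : M) : monsubring S :=
  insubd 0 (mexp k).

Lemma val_mse (M : nmodType) (S : addrClosed M) (k : M) :
  k \in S -> val (mse S k) = mexp k.
Proof. by move=> kS; rewrite insubdK // supported_mexp. Qed.

Lemma ms_valB (M : nmodType) (S : addrClosed M) (x y : monsubring S) :
  val (x - y) = val x - val y.
Proof. exact: (rmorphB (val : monsubring S -> _)). Qed.

Lemma ms_valM (M : nmodType) (S : addrClosed M) (x y : monsubring S) :
  val (x * y) = val x * val y.
Proof. exact: (rmorphM (val : monsubring S -> _)). Qed.

(* The ring morphism out of Z[S] extending a morphism from the monoid S to the
   multiplicative monoid of R. *)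
Section Lift.
Variables (M : nmodType) (S : addrClosed M) (R : comNzRingType) (chi : M -> R).

Definition is_character :=
  chi 0 = 1 /\ {in S &, forall k l, chi (k + l) = chi k * chi l}.

Hypothesis chiP : is_character.

Definition ms_lift (_ : is_character) (x : monsubring S) : R :=
  \sum_(k <- msupp (val x)) chi k *~ mcoeff k (val x).

Lemma ms_liftw (d : {fset M}) x : (msupp (val x) `<=` d)%fset ->
  ms_lift chiP x = \sum_(k <- d) chi k *~ mcoeff k (val x).
Proof.
move=> le; rewrite /ms_lift; apply: big_fset_incl => // k _ /mcoeff_outdom ->.
by rewrite mulr0z.
Qed.

Lemma ms_lift_additive : {morph ms_lift chiP : x y / x - y}.
Proof.
move=> x y; set d := (msupp (val x) `|` msupp (val y))%fset.
rewrite (@ms_liftw d x) ?fsubsetUl // (@ms_liftw d y) ?fsubsetUr //.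
rewrite (@ms_liftw d (x - y)); last first.
  by rewrite ms_valB; apply: (@msuppB_le M int (val x) (val y)).
rewrite -sumrB; apply: eq_bigr => k _.
by rewrite ms_valB (mcoeffB k (val x) (val y)) mulrzBr.
Qed.

HB.instance Definition _ :=
  GRing.isZmodMorphism.Build (monsubring S) R (ms_lift chiP) ms_lift_additive.

Lemma ms_lift_mse k : k \in S -> ms_lift chiP (mse S k) = chi k.
Proof.
move=> kS; rewrite (@ms_liftw [fset k]%fset).
  by rewrite big_seq_fset1 val_mse // /mexp mcoeffUU.
by rewrite val_mse // msuppU_le.
Qed.

Lemma monsubringE (x : monsubring S) :
  x = \sum_(k <- msupp (val x)) mse S k *~ mcoeff k (val x).
Proof.
pose v : {additive monsubring S -> monring M} := val.
apply: val_inj; rewrite [LHS]monringE [RHS](raddf_sum v).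
apply: eq_big_seq => k kx; rewrite [RHS](raddfMz v).
rewrite (_ : v (mse S k) = mexp k) //; apply: val_mse.
by case: x kx => x /= /allP; apply.
Qed.

Lemma mse0 : mse S 0 = 1.
Proof. by apply: val_inj; rewrite val_mse ?rpred0. Qed.

Lemma mseD k l : k \in S -> l \in S -> mse S (k + l) = mse S k * mse S l.
Proof.
by move=> kS lS; apply: val_inj; rewrite ms_valM !val_mse ?rpredD // mexpD.
Qed.

Lemma msupp_monsubring (x : monsubring S) k : k \in msupp (val x) -> k \in S.
Proof. by case: x => x /= /allP; apply. Qed.

Lemma ms_lift_multiplicative : monoid_morphism (ms_lift chiP).
Proof.
split; first by rewrite -mse0 ms_lift_mse ?rpred0 //; case: chiP.
move=> x y; rewrite {1}(monsubringE x) {1}(monsubringE y).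
rewrite mulr_suml raddf_sum /= mulr_suml; apply: eq_big_seq => k kx.
rewrite mulr_sumr raddf_sum /= mulr_sumr; apply: eq_big_seq => l ly.
have kS := msupp_monsubring kx; have lS := msupp_monsubring ly.
rewrite mulrzAl mulrzAr -mseD // !(raddfMz (ms_lift chiP)) /=.
rewrite ms_lift_mse ?rpredD //.
by have [_ ->] := chiP; rewrite // mulrzAl mulrzAr.
Qed.

HB.instance Definition _ :=
  GRing.isMonoidMorphism.Build (monsubring S) R (ms_lift chiP)
    ms_lift_multiplicative.

End Lift.

Definition pairing n (y : 'rV[int]_n) (x : 'cV[int]_n) : int := (y *m x) 0 0.

Definition reflection n (a : 'cV[int]_n) (c : 'rV[int]_n) : 'M[int]_n :=
  1%:M - a *m c.

(* The based root datum of (G^, B^, T^), G^ a split connected reductive group over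
   Z: such triples are classified by reduced based root data.  X = X^*(T^) is
   identified with Z^n (columns), X_*(T^) with its dual (rows).  The dual group G
   has X_*(T) = X, coroots rd_root a and roots rd_coroot a. *)
Record rootDatum (n : nat) := RootDatum {
  rd_idx : finType;
  rd_root : rd_idx -> 'cV[int]_n;
  rd_coroot : rd_idx -> 'rV[int]_n;
  rd_root_inj : injective rd_root;
  rd_coroot_inj : injective rd_coroot;
  rd_pairing2 : forall a, pairing (rd_coroot a) (rd_root a) = 2;
  rd_root_stable : forall a b, exists c,
    rd_root c = reflection (rd_root a) (rd_coroot a) *m rd_root b;
  rd_coroot_stable : forall a b, exists c,
    rd_coroot c = rd_coroot b *m reflection (rd_root a) (rd_coroot a);
  rd_reduced : forall a b (k l : int), k != 0 -> l != 0 ->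
    k *: rd_root a = l *: rd_root b ->
    rd_root b = rd_root a \/ rd_root b = - rd_root a;
  rd_simple : {set rd_idx};
  rd_simple_free : forall c : rd_idx -> int,
    \sum_(i in rd_simple) c i *: rd_root i = 0 ->
    forall i, i \in rd_simple -> c i = 0;
  rd_simple_gen : forall a, exists c : rd_idx -> nat,
    rd_root a = \sum_(i in rd_simple) rd_root i *+ c i \/
    rd_root a = - \sum_(i in rd_simple) rd_root i *+ c i }.

Section RootDatum.
Variables (n : nat) (D : rootDatum n).
Local Notation X := 'cV[int]_n.
Local Notation I := (rd_idx D).
Local Notation root := (@rd_root n D).
Local Notation coroot := (@rd_coroot n D).
Local Notation simple := (@rd_simple n D).
Implicit Types (a b c i j : I) (x y nu lam mu : X) (w : 'M[int]_n) (s t : seq I).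

Definition rd_refl a : 'M[int]_n := reflection (root a) (coroot a).

Definition rd_pos : {set I} :=
  [set a | `[< exists c : I -> nat, root a = \sum_(i in simple) root i *+ c i >]].

Definition pos_cone : {pred X} := fun x =>
  `[< exists c : I -> nat, x = \sum_(a in rd_pos) root a *+ c a >].

Definition in_weyl : {pred 'M[int]_n} := fun w =>
  `[< exists s, w = \prod_(a <- s) rd_refl a >].

Definition antidominant nu :=
  forall a, a \in rd_pos -> pairing (coroot a) nu <= 0.

(* nu_-, the antidominant W-conjugate of nu *)
Definition antidom nu : X :=
  xget nu [set x | antidominant x /\ exists2 w, w \in in_weyl & x = w *m nu].

(* For mu in the root lattice, its pairing with the fundamental coweight of the
   adjoint group attached to the simple root i, that is, the coefficient of i in
   the expansion of mu in the basis of simple roots. *)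
Definition fund_coweight i mu : int :=
  xget (fun=> 0 : int)
    [set c : I -> int | mu = \sum_(j in simple) c j *: root j] i.

Definition rho_ad mu : int := \sum_(i in simple) fund_coweight i mu.

Lemma pairingD (y : 'rV[int]_n) x1 x2 :
  pairing y (x1 + x2) = pairing y x1 + pairing y x2.
Proof. by rewrite /pairing mulmxDr mxE. Qed.

Lemma pairingZ (y : 'rV[int]_n) k x : pairing y (k *: x) = k * pairing y x.
Proof. by rewrite /pairing -scalemxAr mxE. Qed.

Lemma pairingN (y : 'rV[int]_n) x : pairing y (- x) = - pairing y x.
Proof. by rewrite /pairing mulmxN mxE. Qed.

Lemma pairing0 (y : 'rV[int]_n) : pairing y 0 = 0.
Proof. by rewrite /pairing mulmx0 mxE. Qed.

Lemma pairingBl (y z : 'rV[int]_n) k x :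
  pairing (y - k *: z) x = pairing y x - k * pairing z x.
Proof. by rewrite /pairing mulmxBl -scalemxAl !mxE. Qed.

Lemma pairing_sum (y : 'rV[int]_n) (J : finType) (P : pred J) (F : J -> X) :
  pairing y (\sum_(j | P j) F j) = \sum_(j | P j) pairing y (F j).
Proof. by rewrite /pairing mulmx_sumr summxE. Qed.

Lemma pairingM (y : 'rV[int]_n) w x : pairing (y *m w) x = pairing y (w *m x).
Proof. by rewrite /pairing mulmxA. Qed.

Lemma pairing_ext (y z : 'rV[int]_n) : (forall x, pairing y x = pairing z x) -> y = z.
Proof.
move=> H; apply/rowP => k; have := H (delta_mx k 0).
by rewrite /pairing -!colE !mxE.
Qed.

Lemma reflE a x : rd_refl a *m x = x - pairing (coroot a) x *: root a.
Proof.
rewrite /rd_refl /reflection mulmxBl mul1mx -mulmxA; congr (_ - _).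
rewrite [coroot a *m x]mx11_scalar mul_mx_scalar; congr (_ *: _).
Qed.

Lemma reflEr a (y : 'rV[int]_n) : y *m rd_refl a = y - pairing y (root a) *: coroot a.
Proof.
rewrite /rd_refl /reflection mulmxBr mulmx1 mulmxA; congr (_ - _).
rewrite [y *m root a]mx11_scalar mul_scalar_mx; congr (_ *: _).
Qed.

Lemma refl_root a : rd_refl a *m root a = - root a.
Proof. by rewrite reflE rd_pairing2; apply/colP => k; rewrite !mxE; ring. Qed.

Lemma refl_coroot a : coroot a *m rd_refl a = - coroot a.
Proof. by rewrite reflEr rd_pairing2; apply/rowP => k; rewrite !mxE; ring. Qed.

Lemma mx_ext w w' : (forall x, w *m x = w' *m x) -> w = w'.
Proof.
by move=> H; apply/matrixP => k l; have /matrixP/(_ k 0) := H (delta_mx l 0);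
  rewrite -!colE !mxE.
Qed.

Lemma refl_invol a : rd_refl a * rd_refl a = 1.
Proof.
apply: mx_ext => x; rewrite -mulmxE -mulmxA !reflE pairingD pairingN pairingZ.
rewrite rd_pairing2 mul1mx; apply/colP => k; rewrite !mxE; ring.
Qed.

Lemma refl_mulK a x : rd_refl a *m (rd_refl a *m x) = x.
Proof. by rewrite mulmxA mulmxE refl_invol mul1mx. Qed.

Lemma root_neq0 a : root a <> 0.
Proof. by move=> e; have := rd_pairing2 a; rewrite e pairing0. Qed.

(* The W-invariant form, used to compare roots and coroots. *)
Definition rd_form x y : int := \sum_c pairing (coroot c) x * pairing (coroot c) y.

Lemma form_sym x y : rd_form x y = rd_form y x.
Proof. by apply: eq_bigr => c _; rewrite mulrC. Qed.

Lemma formD x y1 y2 : rd_form x (y1 + y2) = rd_form x y1 + rd_form x y2.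
Proof. by rewrite /rd_form -big_split; apply: eq_bigr => c _; rewrite pairingD mulrDr. Qed.

Lemma formZ x k y : rd_form x (k *: y) = k * rd_form x y.
Proof. by rewrite /rd_form mulr_sumr; apply: eq_bigr => c _; rewrite pairingZ mulrCA. Qed.

Lemma formN x y : rd_form x (- y) = - rd_form x y.
Proof. by rewrite -scaleN1r formZ mulN1r. Qed.

Lemma form_sum x (P : pred I) (F : I -> X) :
  rd_form x (\sum_(j | P j) F j) = \sum_(j | P j) rd_form x (F j).
Proof.
elim/big_rec2: _ => [|j u v _ <-]; last exact: formD.
by rewrite /rd_form big1 // => c _; rewrite pairing0 mulr0.
Qed.

Lemma form_refl a x y : rd_form (rd_refl a *m x) (rd_refl a *m y) = rd_form x y.
Proof.
pose f b := sval (cid (rd_coroot_stable a b)).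
have fE b : coroot (f b) = coroot b *m rd_refl a by rewrite /f; case: cid.
have fK : involutive f.
  by move=> b; apply: rd_coroot_inj; rewrite !fE -mulmxA mulmxE refl_invol mulmx1.
rewrite [RHS](reindex_inj (inv_inj fK)); apply: eq_bigr => c _ /=.
by rewrite fE !pairingM.
Qed.

Lemma form_root x a : 2 * rd_form x (root a) =
  pairing (coroot a) x * rd_form (root a) (root a).
Proof.
have := form_refl a x (root a); rewrite refl_root formN form_sym reflE formD -scaleNr.
by rewrite formZ (form_sym _ x) => e; lia.
Qed.

Lemma form_root_gt0 a : 0 < rd_form (root a) (root a).
Proof.
rewrite /rd_form (bigD1 a) //= rd_pairing2.
have : 0 <= \sum_(c | c != a) pairing (coroot c) (root a) * pairing (coroot c) (root a).
  by apply: sumr_ge0 => c _; rewrite -expr2 sqr_ge0.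
by move: (\sum_(c | _) _) => u; lia.
Qed.

(* Roots and coroots are permuted compatibly by reflections. *)
Lemma refl_joint a b : exists c,
  root c = rd_refl a *m root b /\ coroot c = coroot b *m rd_refl a.
Proof.
have [c rc] := rd_root_stable a b; rewrite -/(rd_refl a) in rc.
exists c; split => //; apply: pairing_ext => x; rewrite pairingM.
have e1 := form_root x c; have e2 := form_root (rd_refl a *m x) b.
move: e1; rewrite rc form_refl -{1}(refl_mulK a x) form_refl e2.
by move/(mulIf (lt0r_neq0 (form_root_gt0 b))).
Qed.

Definition rf a b : I := sval (cid (refl_joint a b)).

Lemma root_rf a b : root (rf a b) = rd_refl a *m root b.
Proof. by rewrite /rf; case: cid => c []. Qed.

Lemma coroot_rf a b : coroot (rf a b) = coroot b *m rd_refl a.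
Proof. by rewrite /rf; case: cid => c []. Qed.

Lemma rfK a : involutive (rf a).
Proof. by move=> b; apply: rd_root_inj; rewrite !root_rf refl_mulK. Qed.

Lemma refl_rf a b : rd_refl (rf a b) = rd_refl a * rd_refl b * rd_refl a.
Proof.
rewrite {1}/rd_refl /reflection root_rf coroot_rf.
have -> : rd_refl b = 1 - root b *m coroot b by [].
rewrite (mulrBr (rd_refl a) 1) mulr1 (mulrBl (rd_refl a) (rd_refl a)) refl_invol; congr (_ - _).
by rewrite -!mulmxE !mulmxA.
Qed.

Lemma simple_uniq (c d : I -> int) :
  \sum_(i in simple) c i *: root i = \sum_(i in simple) d i *: root i ->
  forall i, i \in simple -> c i = d i.
Proof.
move=> e i iS; apply/eqP; rewrite -subr_eq0; apply/eqP.
apply: (rd_simple_free (c := fun i => c i - d i)) iS.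
by apply/eqP; rewrite (eq_bigr _ (fun i _ => scalerBl _ _ _)) sumrB e subrr.
Qed.

Lemma natZ (c : I -> nat) :
  \sum_(i in simple) root i *+ c i = \sum_(i in simple) (c i)%:Z *: root i.
Proof. by apply: eq_bigr => i _; rewrite -scaler_nat natz. Qed.

Lemma posP a : reflect
  (exists c : I -> nat, root a = \sum_(i in simple) (c i)%:Z *: root i) (a \in rd_pos).
Proof.
apply: (iffP idP); first by rewrite inE => /asboolP[c]; rewrite natZ; exists c.
by case=> c; rewrite -natZ => e; rewrite inE; apply/asboolP; exists c.
Qed.

Lemma negP' a : a \notin rd_pos ->
  exists c : I -> nat, root a = \sum_(i in simple) (- (c i)%:Z) *: root i.
Proof.
move=> /posP H; have [c [e|e]] := rd_simple_gen a; first by case: H; exists c; rewrite -natZ.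
by exists c; rewrite e natZ -sumrN; apply: eq_bigr => i _; rewrite scaleNr.
Qed.

Lemma simple_root i : i \in simple ->
  root i = \sum_(j in simple) ((j == i)%:R : int) *: root j.
Proof.
move=> iS; rewrite (bigD1 i) //= eqxx scale1r big1 ?addr0 // => j /andP[_ /negPf->].
by rewrite scale0r.
Qed.

Lemma simple_pos i : i \in simple -> i \in rd_pos.
Proof.
move=> iS; apply/posP; exists (fun j => (j == i) : nat).
by rewrite [LHS](simple_root iS); apply: eq_bigr => j _; rewrite natz.
Qed.

Lemma rf_self_neg a : root (rf a a) = - root a.
Proof. by rewrite root_rf refl_root. Qed.

Lemma rf_self_notpos a : a \in rd_pos -> rf a a \notin rd_pos.
Proof.
move=> /posP[c e]; apply/posP => -[d]; rewrite rf_self_neg {1}e => e'.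
apply: (@root_neq0 a); rewrite e big1 // => i iS.
have := @simple_uniq (fun i => - (c i)%:Z) (fun i => (d i)%:Z).
rewrite -e' -sumrN => /(_ _ i iS) H; suff -> : (c i)%:Z = 0 by rewrite scale0r.
by have := H (eq_bigr _ (fun i _ => scaleNr _ _)); lia.
Qed.

Lemma rf_simple_pos i b : i \in simple -> b \in rd_pos -> b != i -> rf i b \in rd_pos.
Proof.
move=> iS /posP[c e] bi; apply: contraT => /negP'[d].
rewrite root_rf reflE; set m := pairing _ _ => e'.
have cd j : j \in simple -> j != i -> c j = 0%N.
  move=> jS ji.
  have := @simple_uniq (fun k => (c k)%:Z - m * (k == i)%:R) (fun k => - (d k)%:Z).
  rewrite -e' => H; have {}H := H _ j jS; move: H; rewrite (negPf ji) /= mulr0 subr0.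
  move=> H; suff: (c j)%:Z = - (d j)%:Z by lia.
  apply: H; rewrite e [in RHS](simple_root iS) scaler_sumr -sumrB.
  by apply: eq_bigr => k _; rewrite scalerBl scalerA.
have {}e : root b = (c i)%:Z *: root i.
  rewrite e (bigD1 i) //= big1 ?addr0 // => j /andP[jS ji].
  by rewrite cd // scale0r.
have ci : (c i)%:Z != 0.
  by apply/eqP => c0; apply: (@root_neq0 b); rewrite e c0 scale0r.
have [] := @rd_reduced _ D i b (c i)%:Z 1 ci isT; first by rewrite e scale1r.
  by move/(@rd_root_inj _ D) => bi'; rewrite bi' eqxx in bi.
move=> eN; have : (c i)%:Z = -1.
  have := congr1 (pairing (coroot i)) eN; rewrite e pairingZ pairingN rd_pairing2.
  by lia.
by lia.
Qed.

(* Induction on the height of a positive root. *)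
Lemma pos_ind (P : I -> Prop) :
  (forall i, i \in simple -> P i) ->
  (forall i a, i \in simple -> a \in rd_pos -> rf i a \in rd_pos ->
     0 < pairing (coroot i) (root a) -> 0 < pairing (coroot a) (root i) ->
     P (rf i a) -> P a) ->
  forall a, a \in rd_pos -> P a.
Proof.
move=> Psimple Pstep.
suff H N a (c : I -> nat) : root a = \sum_(i in simple) (c i)%:Z *: root i ->
    (\sum_(i in simple) c i <= N)%N -> P a.
  by move=> a /posP[c e]; apply: H e (leqnn _).
elim: N a c => [|N IH] a c e cN.
  case: (@root_neq0 a); rewrite e big1 // => i iS; suff -> : c i = 0%N by rewrite scale0r.
  by move: cN; rewrite (bigD1 i) //=; lia.
case: (boolP (a \in simple)) => [/Psimple //|aS].
have apos : a \in rd_pos by apply/posP; exists c.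
have [i iS fi] : exists2 i, i \in simple & 0 < rd_form (root a) (root i).
  apply/exists_inP; apply: contraT; rewrite negb_exists_in => /forall_inP H.
  have := form_root_gt0 a; rewrite {2}e form_sum ltNge.
  rewrite sumr_le0 // => i iS; rewrite formZ mulr_ge0_le0 //.
  by rewrite leNgt H.
have p1 : 0 < pairing (coroot i) (root a).
  by rewrite -(pmulr_lgt0 _ (form_root_gt0 i)) -form_root mulr_gt0 //.
have p2 : 0 < pairing (coroot a) (root i).
  by rewrite -(pmulr_lgt0 _ (form_root_gt0 a)) -form_root form_sym mulr_gt0.
have ai : a != i by apply: contraNneq aS => ->.
have rpos := rf_simple_pos iS apos ai.
apply: (Pstep i) => //; have /posP[d ed] := rpos; apply: (IH _ d ed).
set m := pairing _ _ in p1.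
have cd j : j \in simple -> (d j)%:Z = (c j)%:Z - m * (j == i)%:R.
  apply: (@simple_uniq (fun j => (d j)%:Z) (fun j => (c j)%:Z - m * (j == i)%:R)).
  rewrite -ed root_rf reflE -/m e [in LHS](simple_root iS) scaler_sumr -sumrB.
  by apply: eq_bigr => k _; rewrite scalerBl scalerA.
have e1 : (\sum_(j in simple) c j = c i + \sum_(j in simple | j != i) c j)%N.
  exact: bigD1.
have e2 : (\sum_(j in simple) d j = d i + \sum_(j in simple | j != i) c j)%N.
  rewrite (bigD1 i) //=; congr addn; apply: eq_bigr => j /andP[jS /negPf ji].
  by have := cd j jS; rewrite ji /=; lia.
have := cd i iS; rewrite eqxx /=; lia.
Qed.

Lemma prod_mul s t : \prod_(a <- s ++ t) rd_refl a =
  (\prod_(a <- s) rd_refl a) * (\prod_(a <- t) rd_refl a).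
Proof. exact: big_cat. Qed.

Lemma weylP w : reflect (exists s, w = \prod_(a <- s) rd_refl a) (w \in in_weyl).
Proof. exact: asboolP. Qed.

Lemma weyl1 : 1 \in in_weyl.
Proof. by apply/weylP; exists [::]; rewrite big_nil. Qed.

Lemma weylM : {in in_weyl &, forall w w', w * w' \in in_weyl}.
Proof. by move=> _ _ /weylP[s ->] /weylP[t ->]; apply/weylP; exists (s ++ t); rewrite prod_mul. Qed.

Lemma weyl_refl a : rd_refl a \in in_weyl.
Proof. by apply/weylP; exists [:: a]; rewrite big_seq1. Qed.

Lemma prod_rev s : (\prod_(a <- rev s) rd_refl a) * (\prod_(a <- s) rd_refl a) = 1.
Proof.
elim: s => [|a s IH]; first by rewrite !big_nil mulr1.
rewrite rev_cons -cats1 prod_mul big_seq1 big_cons -mulrA (mulrA (rd_refl a)).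
by rewrite refl_invol mul1r.
Qed.

Lemma weyl_inv w : w \in in_weyl ->
  exists2 w', w' \in in_weyl & w' * w = 1 /\ w * w' = 1.
Proof.
move=> /weylP[s ->]; exists (\prod_(a <- rev s) rd_refl a).
  by apply/weylP; exists (rev s).
by rewrite prod_rev -{1}(revK s) prod_rev.
Qed.

Lemma refl_simple_word a : exists2 s, all [in simple] s & rd_refl a = \prod_(i <- s) rd_refl i.
Proof.
suff H : forall b, b \in rd_pos ->
    exists2 s, all [in simple] s & rd_refl b = \prod_(i <- s) rd_refl i.
  case: (boolP (a \in rd_pos)) => [/H //|/negP'[c e]].
  have [|s sS es] := H (rf a a).
    apply/posP; exists c; rewrite rf_self_neg e -sumrN.
    by apply: eq_bigr => i _; rewrite scaleNr opprK.
  by exists s => //; rewrite -es refl_rf refl_invol mul1r.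
apply: pos_ind => [i iS|i b iS _ _ _ _ [s sS es]].
  by exists [:: i]; rewrite ?big_seq1 //= iS.
exists (i :: rcons s i); first by rewrite /= iS all_rcons iS.
rewrite big_cons -cats1 prod_mul big_seq1 -es refl_rf.
by rewrite !mulrA refl_invol mul1r -mulrA refl_invol mulr1.
Qed.

Lemma weyl_simple_word w : w \in in_weyl ->
  exists2 s, all [in simple] s & w = \prod_(i <- s) rd_refl i.
Proof.
move=> /weylP[s ->]; elim: s => [|a s [t tS et]]; first by exists [::].
have [u uS eu] := refl_simple_word a.
by exists (u ++ t); rewrite ?all_cat ?uS // big_cons prod_mul eu et.
Qed.

Definition act s b : I := foldr rf b s.

Lemma root_act s b : root (act s b) = (\prod_(a <- s) rd_refl a) *m root b.
Proof.
by elim: s => [|a s IH] /=; rewrite ?big_nil ?mul1mx // root_rf IH big_cons mulmxA.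
Qed.

Lemma refl_act s b :
  rd_refl (act s b) * \prod_(a <- s) rd_refl a = (\prod_(a <- s) rd_refl a) * rd_refl b.
Proof.
elim: s => [|a s IH] /=; first by rewrite big_nil mulr1 mul1r.
by rewrite refl_rf big_cons -!mulrA (mulrA (rd_refl a) (rd_refl a)) refl_invol mul1r IH.
Qed.

Lemma deletion s i : all [in simple] s -> i \in simple -> act s i \notin rd_pos ->
  exists t, [/\ all [in simple] t, (size t < size s)%N &
    (\prod_(a <- s) rd_refl a) * rd_refl i = \prod_(a <- t) rd_refl a].
Proof.
elim: s => [|j s IH] /=; first by move=> _ iS; rewrite simple_pos.
move=> /andP[jS sS] iS neg.
case: (boolP (act s i \in rd_pos)) => [pos|/(IH sS iS)[t [tS ts e]]]; last first.
  by exists (j :: t); rewrite /= jS tS ltnS ts !big_cons -mulrA e.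
have ej : act s i = j by apply: contraNeq neg; apply: rf_simple_pos.
exists s; split => //.
by rewrite big_cons -mulrA -refl_act ej mulrA refl_invol mul1r.
Qed.

Lemma pos_coneP x : reflect (exists c : I -> nat, x = \sum_(a in rd_pos) root a *+ c a)
  (x \in pos_cone).
Proof. exact: asboolP. Qed.

Lemma pos_cone_addr : GRing.nmod_closed pos_cone.
Proof.
split; first by apply/pos_coneP; exists (fun=> 0%N); rewrite big1.
move=> _ _ /pos_coneP[c ->] /pos_coneP[d ->]; apply/pos_coneP.
by exists (fun a => c a + d a)%N; rewrite -big_split; apply: eq_bigr => a _; rewrite mulrnDr.
Qed.

Lemma pos_coneD x y : x \in pos_cone -> y \in pos_cone -> x + y \in pos_cone.
Proof. by apply: pos_cone_addr.2. Qed.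

Lemma pos_cone_root a k : a \in rd_pos -> root a *+ k \in pos_cone.
Proof.
move=> ap; apply/pos_coneP; exists (fun b => if b == a then k else 0%N).
by rewrite (bigD1 a) //= eqxx big1 ?addr0 // => b /andP[_ /negPf->].
Qed.

Lemma antidominant_le w lam : w \in in_weyl -> antidominant lam ->
  w *m lam - lam \in pos_cone.
Proof.
move=> /weyl_simple_word[s sS ->] anti; have [N] := ubnP (size s).
elim: N s sS => // N IH s; rewrite ltnS; case/lastP: s => [|s i].
  by rewrite big_nil mul1mx subrr pos_cone_addr.1.
rewrite all_rcons size_rcons => /andP[iS sS] sN.
rewrite -cats1 prod_mul big_seq1.
case: (boolP (act s i \in rd_pos)) => [pos|/(deletion sS iS)[t [tS ts ->]]]; last first.
  by apply: IH => //; lia.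
rewrite -mulmxE -mulmxA reflE mulmxBr -scalemxAr -root_act addrAC.
apply: pos_coneD; first by apply: IH => //; lia.
have : pairing (coroot i) lam <= 0 by apply/anti/simple_pos.
case: (pairing _ _) => [[|k]|k] // _; first by rewrite scale0r oppr0 pos_cone_addr.1.
by rewrite NegzE -scaleNr opprK -[Posz _]natz scaler_nat pos_cone_root.
Qed.

Lemma antidominant_simple nu :
  (forall i, i \in simple -> pairing (coroot i) nu <= 0) -> antidominant nu.
Proof.
move=> H; apply: (@pos_ind (fun a => pairing (coroot a) nu <= 0)) => // i a iS _ _ _ p.
rewrite coroot_rf reflEr pairingBl.
have := H i iS; move: p; move: (pairing (coroot i) nu) (pairing _ (root i)) => u v.
by move: (pairing _ _) => t; nia.
Qed.

Lemma antidominant_exists nu : exists2 w, w \in in_weyl & antidominant (w *m nu).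
Proof.
pose f x := (\sum_(a in rd_pos) `|Num.max (pairing (coroot a) x) 0|)%N.
have [N] := ubnP (f nu); elim: N nu => // N IH nu; rewrite ltnS => fN.
have [/forall_inP H|] := boolP [forall (i | i \in simple), pairing (coroot i) nu <= 0].
  by exists 1; rewrite ?weyl1 // mul1mx; apply: antidominant_simple.
rewrite negb_forall_in => /exists_inP[i iS]; rewrite -ltNge => p.
have [|w wW anti] := IH (rd_refl i *m nu); last first.
  exists (w * rd_refl i); first by rewrite weylM ?weyl_refl.
  by rewrite -mulmxE -mulmxA.
apply: leq_trans fN; rewrite /f (bigD1 i) ?simple_pos //= [ltnRHS](bigD1 i) ?simple_pos //=.
rewrite -pairingM refl_coroot {1}/pairing mulNmx mxE -/(pairing _ _).
rewrite (reindex_inj (inv_inj (rfK i))) /=.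
rewrite (eq_bigl (fun a => (a \in rd_pos) && (a != i))); last first.
  move=> a; apply/andP/andP => -[ap ai].
    have ai' : a != i.
      by apply/eqP => e; move: ap; rewrite e (negPf (rf_self_notpos (simple_pos iS))).
    by split; rewrite // -(rfK i a) rf_simple_pos.
  split; first exact: rf_simple_pos.
  apply/eqP => e; move: (rf_self_notpos (simple_pos iS)).
  by rewrite -{2}e rfK ap.
rewrite (eq_bigr (fun a => `|Num.max (pairing (coroot a) nu) 0|%N)); last first.
  by move=> a _; rewrite coroot_rf pairingM refl_mulK.
rewrite ltn_add2r; lia.
Qed.

Lemma antidomP nu :
  antidominant (antidom nu) /\ exists2 w, w \in in_weyl & antidom nu = w *m nu.
Proof.
have [w wW anti] := antidominant_exists nu.
rewrite /antidom; case: xgetP => [x _ //|/(_ (w *m nu))[]].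
by split => //; exists w.
Qed.

Lemma weyl_antidom_le w nu : w \in in_weyl -> w *m nu - antidom nu \in pos_cone.
Proof.
move=> wW; have [anti [v vW e]] := antidomP nu; have [v' v'W [v'v _]] := weyl_inv vW.
have -> : w *m nu = (w * v') *m antidom nu.
  by rewrite e mulmxA mulmxE -mulrA v'v mulr1.
by apply: antidominant_le => //; apply: weylM.
Qed.

Lemma antidom0 : antidom 0 = 0.
Proof. by have [_ [w _ ->]] := antidomP 0; rewrite mulmx0. Qed.

(* The pairs (nu_1, nu_2) such that e_1^nu_1 (x) e_2^nu_2 is a function on the
   toral submonoid of the Vinberg monoid. *)
Definition vinberg_cone : {pred X * X} := fun p => p.2 + antidom p.1 \in pos_cone.

Lemma vinberg_coneE p : (p \in vinberg_cone) = (p.2 + antidom p.1 \in pos_cone).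
Proof. by []. Qed.

Lemma vinberg_cone_addr : GRing.nmod_closed vinberg_cone.
Proof.
split; first by rewrite vinberg_coneE /= antidom0 addr0; apply: pos_cone_addr.1.
move=> [x1 y1] [x2 y2]; rewrite !vinberg_coneE /= => h1 h2.
have [_ [w wW ->]] := antidomP (x1 + x2).
have -> : y1 + y2 + w *m (x1 + x2) = (y1 + antidom x1) + (y2 + antidom x2) +
    ((w *m x1 - antidom x1) + (w *m x2 - antidom x2)).
  by rewrite mulmxDr; apply/colP => k; rewrite !mxE; ring.
by apply: pos_coneD; apply: pos_coneD => //; apply: weyl_antidom_le.
Qed.

HB.instance Definition _ := GRing.isAddClosed.Build X pos_cone pos_cone_addr.
HB.instance Definition _ := GRing.isAddClosed.Build (X * X)%type vinberg_cone vinberg_cone_addr.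

Lemma fund_coweightE (c : I -> int) i : i \in simple ->
  fund_coweight i (\sum_(j in simple) c j *: root j) = c i.
Proof.
move=> iS; rewrite /fund_coweight; case: xgetP => [d _ /= e|/(_ c)[] //].
by apply/esym; apply: simple_uniq e i iS.
Qed.

Lemma rho_adE (c : I -> int) :
  rho_ad (\sum_(j in simple) c j *: root j) = \sum_(i in simple) c i.
Proof. by apply: eq_bigr => i iS; rewrite fund_coweightE. Qed.

Lemma pos_cone_simple x : x \in pos_cone ->
  exists c : I -> nat, x = \sum_(i in simple) (c i)%:Z *: root i.
Proof.
move=> /pos_coneP[c ->]; elim/big_ind: _ => [|_ _ [d ->] [e ->]|a /posP[d ->]].
- by exists (fun=> 0%N); rewrite big1 // => i _; rewrite scale0r.
- exists (fun i => d i + e i)%N; rewrite -big_split; apply: eq_bigr => i _.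
  by rewrite PoszD scalerDl.
exists (fun i => d i * c a)%N; rewrite -sumrMnl; apply: eq_bigr => i _.
by rewrite -scaler_nat scalerA natz PoszM mulrC.
Qed.

Lemma rho_ad0 : rho_ad 0 = 0.
Proof.
have := rho_adE (fun=> 0); rewrite [X in rho_ad X]big1 => [->|i _].
  by rewrite big1.
by rewrite scale0r.
Qed.

Lemma rho_ad_ge0 x : x \in pos_cone -> 0 <= rho_ad x.
Proof. by move=> /pos_cone_simple[c ->]; rewrite rho_adE sumr_ge0. Qed.

Lemma rho_adD x y : x \in pos_cone -> y \in pos_cone ->
  rho_ad (x + y) = rho_ad x + rho_ad y.
Proof.
move=> /pos_cone_simple[c ->] /pos_cone_simple[d ->]; rewrite -big_split /=.
rewrite (eq_bigr (fun i => ((c i)%:Z + (d i)%:Z) *: root i)) => [|i _].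
  by rewrite !rho_adE big_split.
by rewrite scalerDl.
Qed.

Lemma rho_ad_eq0 x : x \in pos_cone -> rho_ad x = 0 -> x = 0.
Proof.
move=> /pos_cone_simple[c ->]; rewrite rho_adE => /eqP e; rewrite big1 // => i iS.
suff -> : (c i)%:Z = 0 by rewrite scale0r.
by move: e; rewrite psumr_eq0 // => /allP/(_ i); rewrite mem_index_enum iS => /(_ isT)/eqP.
Qed.

(* nu_- is the unique antidominant conjugate of nu. *)
Lemma antidomE w nu : w \in in_weyl -> antidominant (w *m nu) -> w *m nu = antidom nu.
Proof.
move=> wW anti; have [anti' [v vW e]] := antidomP nu.
have [w' w'W [w'w _]] := weyl_inv wW.
have c1 := weyl_antidom_le nu wW.
have c2 := antidominant_le (weylM vW w'W) anti.
move: c2; rewrite mulmxA mulmxE -mulrA w'w mulr1 -e => c2.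
apply/eqP; rewrite -subr_eq0; apply/eqP; apply: (rho_ad_eq0 c1).
have := rho_adD c1 c2; rewrite addrC subrKA subrr rho_ad0.
have := rho_ad_ge0 c1; have := rho_ad_ge0 c2.
by move: (rho_ad _) (rho_ad _) => p q; lia.
Qed.

End RootDatum.

Section ExtendedAffineWeyl.
Variables (n : nat) (D : rootDatum n).
Local Notation X := 'cV[int]_n.

(* The extended affine Weyl group N(F)/T(o_F) of the dual group G, as the
   semidirect product of T(F)/T(o_F) = X_*(T) by N(o_F)/T(o_F) = W, which does not
   depend on F; (nu, w) acts on X_*(T) (x) R by x |-> w x + nu. *)
Definition aff_weyl : Type := (X * {w : 'M[int]_n | w \in in_weyl D})%type.

HB.instance Definition _ := Choice.on aff_weyl.

Definition aw_tr (w : aff_weyl) : X := w.1.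
Definition aw_lin (w : aff_weyl) : 'M[int]_n := val w.2.

Definition aw_make (nu : X) (w : 'M[int]_n) (wW : w \in in_weyl D) : aff_weyl :=
  (nu, exist _ w wW).

Lemma aw_linP (w : aff_weyl) : aw_lin w \in in_weyl D.
Proof. by case: w => nu []. Qed.

Lemma aw_ext (w w' : aff_weyl) : aw_tr w = aw_tr w' -> aw_lin w = aw_lin w' -> w = w'.
Proof. by case: w w' => [x u] [y v]; rewrite /aw_tr /aw_lin /= => -> /val_inj ->. Qed.

Definition aw_mul (w w' : aff_weyl) : aff_weyl :=
  aw_make (aw_tr w + aw_lin w *m aw_tr w') (weylM (aw_linP w) (aw_linP w')).

Definition aw_one : aff_weyl := aw_make 0 (weyl1 D).

Definition weyl_inverse (w : 'M[int]_n) (wW : w \in in_weyl D) : 'M[int]_n :=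
  s2val (cid2 (weyl_inv wW)).

Lemma weyl_inverseP (w : 'M[int]_n) (wW : w \in in_weyl D) :
  [/\ weyl_inverse wW \in in_weyl D, weyl_inverse wW * w = 1 & w * weyl_inverse wW = 1].
Proof. by rewrite /weyl_inverse; case: cid2 => w' /= ? []. Qed.

Lemma weyl_inverse_in (w : 'M[int]_n) (wW : w \in in_weyl D) :
  weyl_inverse wW \in in_weyl D.
Proof. by case: (weyl_inverseP wW). Qed.

Definition aw_inv (w : aff_weyl) : aff_weyl :=
  aw_make (- (weyl_inverse (aw_linP w) *m aw_tr w)) (weyl_inverse_in (aw_linP w)).

Lemma aw_mulA : associative aw_mul.
Proof.
move=> u v w; apply: aw_ext; last exact: mulrA.
by rewrite /aw_tr /aw_lin /= mulmxDr addrA mulmxA.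
Qed.

Lemma aw_mul1 : left_id aw_one aw_mul.
Proof.
by move=> u; apply: aw_ext; rewrite /aw_tr /aw_lin /= ?mul1r // mul1mx add0r.
Qed.

Lemma aw_mulr1 : right_id aw_one aw_mul.
Proof.
by move=> u; apply: aw_ext; rewrite /aw_tr /aw_lin /= ?mulr1 // mulmx0 addr0.
Qed.

Lemma aw_mulV : left_inverse aw_one aw_inv aw_mul.
Proof.
move=> u; apply: aw_ext; rewrite /aw_tr /aw_lin /=; first by rewrite addrC subrr.
by case: (weyl_inverseP (aw_linP u)).
Qed.

Lemma aw_mulrV : right_inverse aw_one aw_inv aw_mul.
Proof.
move=> u; have [_ _ e] := weyl_inverseP (aw_linP u).
apply: aw_ext; rewrite /aw_tr /aw_lin //=.
by rewrite mulmxN mulmxA mulmxE e mul1mx subrr.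
Qed.

HB.instance Definition _ := isGroup.Build aff_weyl
  aw_mulA aw_mul1 aw_mulr1 aw_mulV aw_mulrV.

Definition aw_exp (nu : X) : aff_weyl := aw_make nu (weyl1 D).

(* The base alcove C is the set of x with 0 < <alpha, x> < 1 for all positive alpha, and
   alcove_floor w a is the integer k such that k < <alpha, x> < k + 1 on w(C),
   for alpha = rd_coroot a, a positive:  <alpha, w x> is the sum of
   <alpha, aw_tr w> and <(aw_lin w)^-1 alpha, x>. *)
Definition alcove_floor (w : aff_weyl) (a : rd_idx D) : int :=
  pairing (rd_coroot a) (aw_tr w) -
  (~~ [exists b in rd_pos D, rd_coroot b == rd_coroot a *m aw_lin w])%:Z.

(* The number of affine root hyperplanes separating C from w(C). *)
Definition aw_length (w : aff_weyl) : nat :=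
  (\sum_(a in rd_pos D) `|alcove_floor w a|)%N.

(* The reflection in the affine hyperplane <alpha, x> = k, alpha = rd_coroot a. *)
Definition aff_refl (a : rd_idx D) (k : int) : aff_weyl :=
  aw_make (k *: rd_root a) (weyl_refl a).

(* Reflections in the walls of C: the affine reflections s such that the
   hyperplane of s is the only one separating C from s(C). *)
Definition simple_aff (s : aff_weyl) : Prop :=
  (exists a k, s = aff_refl a k) /\ aw_length s = 1%N.

(* For w(C) and ws(C) adjacent along H: w(C) lies on the negative side of H and
   ws(C) on its positive side for the antidominant orientation, the positive
   side of <alpha, x> = k (alpha > 0) being the side <alpha, x> < k. *)
Definition positive_crossing (w s : aff_weyl) : bool :=
  [exists a in rd_pos D, alcove_floor (w * s)%g a < alcove_floor w a].

Lemma aw_length_exp (nu : X) :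
  aw_length (aw_exp nu) = (\sum_(a in rd_pos D) `|pairing (rd_coroot a) nu|)%N.
Proof.
apply: eq_bigr => a ap; rewrite /alcove_floor /aw_lin /= mulmx1.
by case: exists_inP => [_|[]]; rewrite ?subr0 //; exists a.
Qed.

Lemma aw_length1 : aw_length 1%g = 0%N.
Proof. by rewrite (aw_length_exp 0) big1 // => a _; rewrite pairing0. Qed.

Lemma aw_expD (x y : X) : aw_exp (x + y) = (aw_exp x * aw_exp y)%g.
Proof. by apply: aw_ext; rewrite /aw_tr /aw_lin /= ?mul1mx // mulr1. Qed.

End ExtendedAffineWeyl.

Definition is_basis (R : nzRingType) (V : lmodType R) (I : eqType) (b : I -> V) : Prop :=
  (forall (s : seq I) (c : I -> R), uniq s -> \sum_(i <- s) c i *: b i = 0 ->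
     forall i, i \in s -> c i = 0) /\
  (forall v : V, exists (s : seq I) (c : I -> R), v = \sum_(i <- s) c i *: b i).

(* The generic Iwahori Hecke algebra H(q), with Z[q] = {poly int} and q = 'X. *)
Record genericHecke (n : nat) (D : rootDatum n) := GenericHecke {
  gh_alg :> algType {poly int};
  gh_T : aff_weyl D -> gh_alg;
  gh_basis : is_basis gh_T;
  gh_braid : forall w w' : aff_weyl D,
    (aw_length w + aw_length w')%N = aw_length (w * w')%g ->
    gh_T w * gh_T w' = gh_T (w * w')%g;
  gh_quadratic : forall s, simple_aff s ->
    gh_T s ^+ 2 = 'X%:A + ('X - 1) *: gh_T s }.

(* The Bernstein basis for the antidominant orientation: along a reduced
   expression w = u s_1 .. s_r, E(w) is the product of T_u and of the T_(s_i) or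
   T_(s_i) - (q - 1) = q T_(s_i)^-1 according to whether the i-th crossing is
   positive or negative.  That this is a well defined basis satisfying the product
   formula is due to Vigneras.  The exponent of q below is an integer since
   lengths are subadditive and l(e^nu) + l(w) - l(e^nu w) is even. *)
Record bernsteinBasis (n : nat) (D : rootDatum n) (H : genericHecke D) :=
  BernsteinBasis {
  bb_E : aff_weyl D -> H;
  bb_length0 : forall u, aw_length u = 0%N -> bb_E u = gh_T H u;
  bb_step : forall w s, simple_aff s -> aw_length (w * s)%g = (aw_length w).+1 ->
    bb_E (w * s)%g = bb_E w *
      (if positive_crossing w s then gh_T H s else gh_T H s - ('X - 1)%:A);
  bb_basis : is_basis bb_E;
  bb_product : forall nu w,
    bb_E (aw_exp D nu) * bb_E w =
      'X^((aw_length (aw_exp D nu) + aw_length w - aw_length (aw_exp D nu * w)%g)./2)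
        *: bb_E (aw_exp D nu * w)%g }.

Section BernsteinSubalgebra.
Variables (n : nat) (D : rootDatum n) (H : genericHecke D) (E : bernsteinBasis H).

(* A(q), the Z[q]-span of the E(nu) = E(e^nu). *)
Definition bern_span : {pred H} := fun h =>
  `[< exists s : seq ('cV[int]_n * {poly int}),
        h = \sum_(p <- s) p.2 *: bb_E E (aw_exp D p.1) >].

Lemma bern_spanP h : reflect (exists s : seq ('cV[int]_n * {poly int}),
    h = \sum_(p <- s) p.2 *: bb_E E (aw_exp D p.1)) (h \in bern_span).
Proof. exact: asboolP. Qed.

Lemma gh_T1 : gh_T H 1%g = 1.
Proof.
have T1 w : gh_T H 1%g * gh_T H w = gh_T H w.
  by rewrite gh_braid ?mul1g // aw_length1.
have [_ /(_ 1)[s [c e]]] := gh_basis H.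
rewrite -[LHS]mulr1 [in LHS]e [in RHS]e mulr_sumr; apply: eq_bigr => w _.
by rewrite -scalerAr T1.
Qed.

Lemma bb_E1 : bb_E E 1%g = 1.
Proof. by rewrite bb_length0 ?gh_T1 // aw_length1. Qed.

Lemma bern_span_E nu : bb_E E (aw_exp D nu) \in bern_span.
Proof. by apply/bern_spanP; exists [:: (nu, 1)]; rewrite big_seq1 scale1r. Qed.

Lemma bern_span0 : 0 \in bern_span.
Proof. by apply/bern_spanP; exists [::]; rewrite big_nil. Qed.

Lemma bern_spanD : {in bern_span &, forall x y, x + y \in bern_span}.
Proof.
move=> _ _ /bern_spanP[s ->] /bern_spanP[t ->]; apply/bern_spanP.
by exists (s ++ t); rewrite big_cat.
Qed.

Lemma bern_spanZ a : {in bern_span, forall x, a *: x \in bern_span}.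
Proof.
move=> _ /bern_spanP[s ->]; apply/bern_spanP; exists [seq (p.1, a * p.2) | p <- s].
by rewrite big_map scaler_sumr; apply: eq_bigr => p _; rewrite scalerA.
Qed.

Lemma bern_span_sum (J : Type) (r : seq J) (F : J -> H) :
  (forall j, F j \in bern_span) -> \sum_(j <- r) F j \in bern_span.
Proof.
by move=> FB; elim/big_ind: _ => // [|x y]; [apply: bern_span0|apply: bern_spanD].
Qed.

Lemma bern_span_closed : GRing.subsemialg_closed bern_span.
Proof.
split; [|split|exact: bern_spanZ|].
- by rewrite -bb_E1; apply: (bern_span_E 0).
- exact: bern_span0.
- exact: bern_spanD.
move=> _ _ /bern_spanP[s ->] /bern_spanP[t ->].
rewrite mulr_suml; apply: bern_span_sum => p.
rewrite mulr_sumr; apply: bern_span_sum => r.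
rewrite -scalerAl -scalerAr bb_product -aw_expD.
by do 3 apply: bern_spanZ; apply: bern_span_E.
Qed.

(* The algebra A(q). *)
Record bernAlg := BernAlg { ba_val : H; _ : ba_val \in bern_span }.

HB.instance Definition _ := [isSub for ba_val].
HB.instance Definition _ := [Choice of bernAlg by <:].
HB.instance Definition _ :=
  GRing.SubChoice_isSubAlgebra.Build {poly int} H bern_span bernAlg bern_span_closed.

(* E(nu) as an element of A(q). *)
Definition ba_E (nu : 'cV[int]_n) : bernAlg := BernAlg (bern_span_E nu).

End BernsteinSubalgebra.

Section Vinberg.
Variables (n : nat) (D : rootDatum n).
Local Notation X := 'cV[int]_n.

(* Z[X^*(T_ad)_pos] *)
Definition pos_ring : Type := monsubring (pos_cone D : addrClosed X).

HB.instance Definition _ := GRing.ComNzRing.on pos_ring.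

(* The ring of functions of the toral submonoid of the Vinberg monoid, as a
   subring of Z[T] (x) Z[T] = Z[X x X], e_1^nu_1 (x) e_2^nu_2 being e^(nu_1, nu_2). *)
Definition vinberg_ring : Type :=
  monsubring (vinberg_cone D : addrClosed (X * X)%type).

HB.instance Definition _ := GRing.ComNzRing.on vinberg_ring.

(* e_1^nu_1 (x) e_2^nu_2, for (nu_1, nu_2) in vinberg_cone D. *)
Definition vexp (nu1 nu2 : X) : vinberg_ring := mse (vinberg_cone D) (nu1, nu2).

Lemma vinberg_cone2 mu : mu \in pos_cone D -> (0, mu) \in vinberg_cone D.
Proof. by move=> h; rewrite vinberg_coneE /= antidom0 addr0. Qed.

Lemma vinberg_cone_antidom nu : (nu, - antidom D nu) \in vinberg_cone D.
Proof. by rewrite vinberg_coneE /= addNr rpred0. Qed.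

Lemma vstr_character : is_character (pos_cone D) (vexp 0).
Proof.
split; first exact: mse0.
move=> k l kP lP.
have e : (0, k + l) = (0, k) + (0, l) :> X * X by rewrite -[in LHS](addr0 0).
rewrite /vexp e; exact: mseD (vinberg_cone2 kP) (vinberg_cone2 lP).
Qed.

(* bar e^mu |-> 1 (x) e_2^mu *)
Definition vinberg_str : {rmorphism pos_ring -> vinberg_ring} := ms_lift vstr_character.

Lemma rho_character :
  is_character (pos_cone D) (fun mu => 'X^(`|rho_ad D mu|%N) : {poly int}).
Proof.
split; first by rewrite rho_ad0.
move=> k l kP lP; rewrite rho_adD // -exprD; congr ('X^_).
by have := rho_ad_ge0 kP; have := rho_ad_ge0 lP; lia.
Qed.

(* bar e^mu |-> q^<mu, rho_ad>; the pairing is nonnegative on pos_cone D. *)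
Definition rho_eval : {rmorphism pos_ring -> {poly int}} := ms_lift rho_character.

End Vinberg.

(* C, with r and s, is the pushout of f and g among commutative rings; that is,
   Spec C is the base change of Spec B1 -> Spec A along Spec B2 -> Spec A. *)
Definition is_base_change (A B1 B2 C : comNzRingType)
    (f : {rmorphism A -> B1}) (g : {rmorphism A -> B2})
    (r : {rmorphism B1 -> C}) (s : {rmorphism B2 -> C}) : Prop :=
  (forall a, r (f a) = s (g a)) /\
  forall (R : comPzRingType) (u : {rmorphism B1 -> R}) (v : {rmorphism B2 -> R}),
    (forall a, u (f a) = v (g a)) ->
    exists h : {rmorphism C -> R},
      [/\ forall b, h (r b) = u b, forall b, h (s b) = v b &
        forall h' : {rmorphism C -> R},
          (forall b, h' (r b) = u b) -> (forall b, h' (s b) = v b) -> h' =1 h].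

(* Main.v *)
Require Import Defs.
From HB Require Import structures.
From mathcomp Require Import all_boot all_order all_algebra.
From mathcomp Require Import boolp.
From mathcomp Require Import zify ring.

Set Implicit Arguments.
Unset Strict Implicit.
Unset Printing Implicit Defensive.

Import GRing.Theory.
Local Open Scope ring_scope.

(** Both sides are governed by the same 2-cocycle on the lattice.  In A(q),
    E(x) E(y) = q^m E(x + y) with 2 m = l(x) + l(y) - l(x + y).  On the Vinberg
    side, write F(x) for the restriction of e_1^x (x) e_2^(-x_-).  In the monoid
    algebra, the product of these elements for x and y is 1 (x) e_2^mu times the
    one for x + y, where mu = (x + y)_- - x_- - y_- is a sum of positive roots
    ([antidom_defect_pos]), and the base change turns 1 (x) e_2^mu into
    q^<mu, rho_ad>.

    The exponents agree ([aw_length_defect]): the length of a translation is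
    invariant under the Weyl group and hence equal to - <2 rho^, x_->, where
    2 rho^ is the sum of the positive coroots, while 2 rho^ pairs to 2 with each
    simple root and so restricts to 2 rho_ad on the root lattice.  As the E(x)
    form a basis of A(q), sending E(x) to F(x) defines a morphism B of algebras.

    Its inverse comes from the universal property of the base change, with no need
    to know a basis of the target.  Since A(q) is commutative, the rule
    e_1^x (x) e_2^y |-> q^<y + x_-, rho_ad> E(x) ([vinberg_bern]) is a ring morphism
    that is compatible with bar e^mu |-> q^<mu, rho_ad>, so it factors through a
    morphism h from the base change to A(q).  Then h B = id holds on the basis E(x),
    and B h = id by the uniqueness part of the universal property, because
    e_1^x (x) e_2^y restricts to q^<y + x_-, rho_ad> F(x) ([restr_vexp]). *)

(** * Lengths of translations and the coweight rho *)

Section LengthAndRho.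
Variables (n : nat) (D : rootDatum n).
Implicit Types (i : rd_idx D) (nu x y : 'cV[int]_n).

(** A simple reflection permutes the positive coroots other than its own, which it
    negates.  Applied to a linear f this computes the pairing of the sum of the
    positive coroots with a simple root; applied to an absolute value it shows that
    lengths are invariant. *)
Lemma sum_coroot_refl (V : nmodType) (f : 'rV[int]_n -> V) i :
  i \in rd_simple D ->
  \sum_(a in rd_pos D) f (rd_coroot a *m rd_refl i) + f (rd_coroot i) =
  \sum_(a in rd_pos D) f (rd_coroot a) + f (- rd_coroot i).
Proof.
move=> iS; have ip := simple_pos iS.
rewrite (bigD1 i) //= refl_coroot [in RHS](bigD1 i) //=.
suff -> : \sum_(a in rd_pos D | a != i) f (rd_coroot a *m rd_refl i) =
          \sum_(a in rd_pos D | a != i) f (rd_coroot a).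
  by rewrite [LHS]addrC [LHS]addrA [LHS]addrAC.
rewrite [RHS](reindex_inj (inv_inj (rfK i))) /=.
have stab a : a \in rd_pos D -> a != i -> (rf i a \in rd_pos D) && (rf i a != i).
  move=> ap ai; rewrite rf_simple_pos //=; apply: contraL ap => /eqP e.
  by rewrite -(rfK i a) e rf_self_notpos.
apply: eq_big => [a|a _]; last by rewrite coroot_rf.
apply/andP/andP => -[ap ai]; apply/andP; first exact: stab.
by rewrite -(rfK i a); apply: stab.
Qed.

Lemma sum_coroot_simple i : i \in rd_simple D ->
  \sum_(a in rd_pos D) pairing (rd_coroot a) (rd_root i) = 2.
Proof.
move=> iS; have := sum_coroot_refl (fun z => pairing z (rd_root i)) iS.
rewrite rd_pairing2 (_ : pairing (- _) _ = -2); last first.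
  by rewrite -refl_coroot pairingM refl_root pairingN rd_pairing2.
rewrite (eq_bigr (fun a => - pairing (rd_coroot a) (rd_root i))) => [|a _].
  by rewrite sumrN; move: (\sum_(a in _) _) => S; lia.
by rewrite pairingM refl_root pairingN.
Qed.

(** On the root lattice, the sum of the positive coroots is twice the sum of the
    fundamental coweights, as both pair to 2 with each simple root. *)
Lemma sum_coroot_rho_ad x : x \in pos_cone D ->
  \sum_(a in rd_pos D) pairing (rd_coroot a) x = 2 * rho_ad D x.
Proof.
move=> /pos_cone_simple[c ->]; rewrite rho_adE mulr_sumr.
rewrite (eq_bigr _ (fun a _ => pairing_sum _ _ _)) exchange_big /=.
apply: eq_bigr => i iS; rewrite -(sum_coroot_simple iS) mulr_suml.
by apply: eq_bigr => a _; rewrite pairingZ mulrC.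
Qed.

Lemma aw_length_refl i nu : i \in rd_simple D ->
  aw_length (aw_exp D (rd_refl i *m nu)) = aw_length (aw_exp D nu).
Proof.
move=> iS; rewrite !aw_length_exp.
have := sum_coroot_refl (fun z => `|pairing z nu|%N) iS.
have -> : pairing (- rd_coroot i) nu = - pairing (rd_coroot i) nu.
  by rewrite /pairing mulNmx mxE.
rewrite abszN => /addIn <-.
by apply: eq_bigr => a _; rewrite pairingM.
Qed.

Lemma aw_length_weyl w nu : w \in in_weyl D ->
  aw_length (aw_exp D (w *m nu)) = aw_length (aw_exp D nu).
Proof.
move=> /weyl_simple_word[s sS ->].
elim: s sS => [|i s IH] /=; first by rewrite big_nil mul1mx.
by move=> /andP[iS sS]; rewrite big_cons -mulmxE -mulmxA aw_length_refl // IH.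
Qed.

(** Replacing nu by its antidominant conjugate keeps the length and makes all the
    pairings with positive coroots nonpositive, so that the length becomes linear
    in that conjugate. *)
Lemma aw_length_antidom nu :
  (aw_length (aw_exp D nu))%:Z =
  - \sum_(a in rd_pos D) pairing (rd_coroot a) (antidom D nu).
Proof.
have [anti [w wW e]] := antidomP D nu.
rewrite -(aw_length_weyl nu wW) -e aw_length_exp -sumrN.
rewrite -[Posz _]natz natr_sum; apply: eq_bigr => a ap.
by have := anti a ap; rewrite natz; lia.
Qed.

(** The cocycle measuring how far nu |-> nu_- is from being additive. *)
Definition antidom_defect x y := antidom D (x + y) - antidom D x - antidom D y.

(** If w takes x + y to its antidominant conjugate, the defect is the sum of
    w x - x_- and w y - y_-, and every conjugate of x lies above x_-. *)
Lemma antidom_defect_pos x y : antidom_defect x y \in pos_cone D.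
Proof.
rewrite /antidom_defect; have [_ [w wW ->]] := antidomP D (x + y).
rewrite mulmxDr -[_ - _ - _]addrA addrACA.
by rewrite pos_coneD ?weyl_antidom_le.
Qed.

(** The comparison of exponents that makes the isomorphism multiplicative: q occurs
    with the left exponent in E(x) E(y), and with the right one in the product of
    the corresponding functions on the Vinberg side. *)
Lemma aw_length_defect x y :
  ((aw_length (aw_exp D x) + aw_length (aw_exp D y) -
    aw_length (aw_exp D (x + y)))./2 = `|rho_ad D (antidom_defect x y)|)%N.
Proof.
have ge0 := rho_ad_ge0 (antidom_defect_pos x y).
have := sum_coroot_rho_ad (antidom_defect_pos x y).
rewrite (eq_bigr (fun a => pairing (rd_coroot a) (antidom D (x + y)) -
   pairing (rd_coroot a) (antidom D x) - pairing (rd_coroot a) (antidom D y))) => [|a _].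
  rewrite !sumrB.
  have := aw_length_antidom x; have := aw_length_antidom y.
  have := aw_length_antidom (x + y); move: ge0.
  move: (aw_length _) (aw_length _) (aw_length _) (rho_ad _ _) => p q r t.
  move: (\sum_(a in _) _) (\sum_(a in _) _) (\sum_(a in _) _) => u v w.
  by lia.
by rewrite !pairingD !pairingN.
Qed.

End LengthAndRho.

(** * Linear maps defined on a basis *)

Section LinearExtension.
Variables (R : nzRingType) (V W : lmodType R) (I : eqType).
Variables (b : I -> V) (F : I -> W).
Implicit Type s : seq (I * R).

(** Turns a combination with possibly repeated indices into one to which linear
    independence applies. *)
Lemma sum_collect (U : lmodType R) (g : I -> U) s :
  \sum_(p <- s) p.2 *: g p.1 =
  \sum_(i <- undup [seq p.1 | p <- s]) (\sum_(p <- s | p.1 == i) p.2) *: g i.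
Proof.
have e i : (\sum_(p <- s | p.1 == i) p.2) *: g i =
           \sum_(p <- s | p.1 == i) p.2 *: g p.1.
  by rewrite scaler_suml; apply: eq_bigr => p /eqP ->.
rewrite (eq_bigr _ (fun i _ => e i)) (exchange_big_dep xpredT) //= [LHS]big_seq [RHS]big_seq.
apply: eq_bigr => p ps; rewrite -big_filter (_ : [seq _ <- _ | _] = [:: p.1]) ?big_seq1 //.
rewrite (eq_filter (a2 := pred1 p.1)) => [|i]; last by rewrite /= eq_sym.
by rewrite filter_pred1_uniq ?undup_uniq // mem_undup map_f.
Qed.

Lemma basis_relation s : is_basis b ->
  \sum_(p <- s) p.2 *: b p.1 = 0 -> \sum_(p <- s) p.2 *: F p.1 = 0.
Proof.
move=> [free _]; rewrite !sum_collect => /free-/(_ (undup_uniq _)) s0.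
by rewrite big_seq big1 // => i /s0 ->; rewrite scale0r.
Qed.

(** The value at v is read off an arbitrarily chosen expansion of v; by
    [basis_relation] it does not depend on the choice, whence linearity. *)
Lemma basis_linear : is_basis b -> exists f : {linear V -> W}, forall i, f (b i) = F i.
Proof.
move=> bP; have rep v : exists s, v = \sum_(p <- s) p.2 *: b p.1.
  have [s [c ->]] := bP.2 v; exists [seq (i, c i) | i <- s].
  by rewrite big_map.
pose r v := sval (cid (rep v)); pose f v := \sum_(p <- r v) p.2 *: F p.1.
have rE v : v = \sum_(p <- r v) p.2 *: b p.1 by rewrite /r; case: cid.
have fE s : f (\sum_(p <- s) p.2 *: b p.1) = \sum_(p <- s) p.2 *: F p.1.
  apply/eqP; rewrite -subr_eq0; apply/eqP; set v := \sum_(p <- s) _.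
  have := @basis_relation (r v ++ [seq (p.1, - p.2) | p <- s]) bP.
  rewrite !big_cat !big_map /= -rE.
  rewrite !(eq_bigr _ (fun p _ => scaleNr _ _)) !sumrN subrr.
  by apply.
have flin : linear f.
  move=> a u v; rewrite {1}(rE u) {1}(rE v).
  have := fE ([seq (p.1, a * p.2) | p <- r u] ++ r v).
  rewrite !big_cat !big_map /= !(eq_bigr _ (fun p _ => esym (scalerA _ _ _))).
  by rewrite -!scaler_sumr.
pose fL := GRing.isLinear.Build _ _ _ _ f flin.
pose g : {linear V -> W} := HB.pack f fL.
exists g => i; have := fE [:: (i, 1)].
by rewrite !big_seq1 !scale1r.
Qed.

Lemma basis_linear_ext (f g : {linear V -> W}) : is_basis b ->
  (forall i, f (b i) = g (b i)) -> f =1 g.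
Proof.
move=> [_ span] fg v; have [s [c ->]] := span v.
by rewrite !linear_sum; apply: eq_bigr => i _; rewrite !linearZ_LR fg.
Qed.

End LinearExtension.

Lemma linear_lrmorphism (R : nzRingType) (A B : lalgType R) (f : {linear A -> B}) :
  monoid_morphism f -> exists g : {lrmorphism A -> B}, g =1 f.
Proof.
move=> fM; pose fM' := GRing.isMonoidMorphism.Build _ _ (f : A -> B) fM.
pose fL := GRing.isLinear.Build _ _ _ _ (f : A -> B) (linearP f).
pose g : {lrmorphism A -> B} := HB.pack (f : A -> B) fL fM'.
by exists g.
Qed.

(** * The Bernstein subalgebra as a target of the Vinberg ring *)

Lemma monsubring_ext (M : nmodType) (S : addrClosed M) (V : zmodType)
    (f g : {additive monsubring S -> V}) :
  {in S, forall k, f (mse S k) = g (mse S k)} -> f =1 g.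
Proof.
move=> fg x; rewrite (monsubringE x) !raddf_sum big_seq [RHS]big_seq.
by apply: eq_bigr => k /msupp_monsubring kS; rewrite !raddfMz fg.
Qed.

Lemma vinberg_str_mse n (D : rootDatum n) mu : mu \in pos_cone D ->
  vinberg_str D (mse (pos_cone D) mu) = vexp D 0 mu.
Proof. exact: (ms_lift_mse (vstr_character D)). Qed.

Lemma rho_eval_mse n (D : rootDatum n) mu : mu \in pos_cone D ->
  rho_eval D (mse (pos_cone D) mu) = 'X^(`|rho_ad D mu|).
Proof. exact: (ms_lift_mse (rho_character D)). Qed.

Section BernsteinAlgebra.
Variables (n : nat) (D : rootDatum n) (H : genericHecke D) (E : bernsteinBasis H).
Implicit Types x y : 'cV[int]_n.

Lemma ba_E_basis : is_basis (ba_E E).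
Proof.
have [free _] := bb_basis E.
pose v : {linear bernAlg E -> H} := val.
split=> [s c us|h].
  move=> /(congr1 v); rewrite linear0 linear_sum => s0 i iS.
  have := free [seq aw_exp D x | x <- s] (fun w => c (aw_tr w)).
  rewrite map_inj_uniq => [|x y /(congr1 (@aw_tr _ _)) //].
  rewrite big_map => /(_ us)/(_ _)/(_ (aw_exp D i) (map_f _ iS)); apply.
  by rewrite -[RHS]s0; apply: eq_bigr => x _; rewrite linearZ.
have [s e] := bern_spanP E _ (valP h).
exists (undup [seq p.1 | p <- s]), (fun i => \sum_(p <- s | p.1 == i) p.2).
by rewrite -sum_collect; apply: val_inj; rewrite [LHS]e [RHS](linear_sum v).
Qed.

Lemma ba_E0 : ba_E E 0 = 1.
Proof. by apply: val_inj; rewrite [LHS]bb_E1. Qed.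

Lemma ba_E_mul x y :
  ba_E E x * ba_E E y = 'X^(`|rho_ad D (antidom_defect D x y)|) *: ba_E E (x + y).
Proof.
apply: val_inj; rewrite /= [LHS]bb_product -aw_expD aw_length_defect.
by [].
Qed.

(** The exponent of q in E(x) E(y) is symmetric in x and y. *)
Lemma ba_mulC : @commutative (bernAlg E) _ *%R.
Proof.
have EC x y : ba_E E x * ba_E E y = ba_E E y * ba_E E x.
  by rewrite !ba_E_mul /antidom_defect (addrC x) addrAC.
move=> g h; have [[s [c ->]] [t [d ->]]] := (ba_E_basis.2 g, ba_E_basis.2 h).
rewrite mulr_suml [RHS]mulr_sumr; apply: eq_bigr => x _.
rewrite mulr_sumr mulr_suml; apply: eq_bigr => y _.
by rewrite -!scalerAl -!scalerAr EC !scalerA mulrC.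
Qed.

(* Makes A(q) an admissible test object for the universal property of the base
   change, which only speaks of commutative rings. *)
HB.instance Definition _ :=
  GRing.PzRing_hasCommutativeMul.Build (bernAlg E) ba_mulC.

(** The value forced on e_1^x (x) e_2^y by sending e_1^x (x) e_2^(-x_-) to E(x) and
    1 (x) e_2^mu to q^<mu, rho_ad>, because
    e_1^x (x) e_2^y = (1 (x) e_2^(y + x_-)) (e_1^x (x) e_2^(-x_-)). *)
Definition bern_char (p : 'cV[int]_n * 'cV[int]_n) : bernAlg E :=
  'X^(`|rho_ad D (p.2 + antidom D p.1)|) *: ba_E E p.1.

Lemma bern_charP : is_character (vinberg_cone D) bern_char.
Proof.
split; first by rewrite /bern_char /= antidom0 addr0 rho_ad0 expr0 scale1r ba_E0.
move=> [x1 x2] [y1 y2]; rewrite !vinberg_coneE /bern_char /= => xP yP.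
rewrite -scalerAl -scalerAr ba_E_mul !scalerA -!exprD; congr ('X^_ *: _).
have -> : x2 + y2 + antidom D (x1 + y1) =
    (x2 + antidom D x1) + (y2 + antidom D y1) + antidom_defect D x1 y1.
  by apply/colP => k; rewrite !mxE; ring.
have dP := antidom_defect_pos D x1 y1.
rewrite (rho_adD (pos_coneD xP yP) dP) (rho_adD xP yP).
have := rho_ad_ge0 xP; have := rho_ad_ge0 yP; have := rho_ad_ge0 dP.
by move: (rho_ad _ _) (rho_ad _ _) (rho_ad _ _) => p q r; lia.
Qed.

Definition vinberg_bern : {rmorphism vinberg_ring D -> bernAlg E} :=
  ms_lift bern_charP.

Lemma vinberg_bern_vexp x y : y + antidom D x \in pos_cone D ->
  vinberg_bern (vexp D x y) = 'X^(`|rho_ad D (y + antidom D x)|) *: ba_E E x.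
Proof. exact: (ms_lift_mse bern_charP (k := (x, y))). Qed.

Lemma vinberg_bern_str a : vinberg_bern (vinberg_str D a) = in_alg (bernAlg E) (rho_eval D a).
Proof.
apply: (monsubring_ext (f := vinberg_bern \o vinberg_str D)
  (g := in_alg (bernAlg E) \o rho_eval D)) => mu muP /=.
rewrite vinberg_str_mse // rho_eval_mse //.
by rewrite vinberg_bern_vexp antidom0 addr0 // ba_E0.
Qed.

End BernsteinAlgebra.

(** * Products in the base change *)

Section BaseChange.
Variables (n : nat) (D : rootDatum n).
Variables (C : comAlgType {poly int}) (restr : {rmorphism vinberg_ring D -> C}).
Hypothesis restrP : forall a, restr (vinberg_str D a) = in_alg C (rho_eval D a).
Implicit Types x y : 'cV[int]_n.

Lemma vexpD x1 x2 y1 y2 : x2 + antidom D x1 \in pos_cone D ->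
  y2 + antidom D y1 \in pos_cone D ->
  vexp D x1 x2 * vexp D y1 y2 = vexp D (x1 + y1) (x2 + y2).
Proof. by move=> xP yP; rewrite /vexp -mseD. Qed.

(** The elements e_1^x (x) e_2^(-x_-) generate: any other e_1^x (x) e_2^y is such an
    element times 1 (x) e_2^mu with mu = y + x_- in the positive cone, and 1 (x) e_2^mu
    becomes a power of q. *)
Lemma restr_vexp x y : y + antidom D x \in pos_cone D ->
  restr (vexp D x y) =
  'X^(`|rho_ad D (y + antidom D x)|) *: restr (vexp D x (- antidom D x)).
Proof.
move=> xyP.
have -> : vexp D x y = vexp D 0 (y + antidom D x) * vexp D x (- antidom D x).
  by rewrite vexpD ?add0r ?addrK // ?antidom0 ?addr0 // addNr rpred0.
rewrite rmorphM -[RHS]mulr_algl; congr (_ * _).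
by rewrite -(vinberg_str_mse xyP) restrP (rho_eval_mse xyP).
Qed.

Lemma restr_vexp_antidom_mul x y :
  restr (vexp D x (- antidom D x)) * restr (vexp D y (- antidom D y)) =
  'X^(`|rho_ad D (antidom_defect D x y)|) *:
    restr (vexp D (x + y) (- antidom D (x + y))).
Proof.
have e : - antidom D x - antidom D y + antidom D (x + y) = antidom_defect D x y.
  by rewrite addrC addrA.
have addNP z : - antidom D z + antidom D z \in pos_cone D by rewrite addNr rpred0.
rewrite -(rmorphM restr) (vexpD (addNP x) (addNP y)).
by rewrite [LHS]restr_vexp e // antidom_defect_pos.
Qed.

End BaseChange.

(** * The isomorphism *)

Theorem theorem5p4p2 (n : nat) (D : rootDatum n)
    (H : genericHecke D) (E : bernsteinBasis H)
    (C : comAlgType {poly int}) (restr : {rmorphism vinberg_ring D -> C})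
    (hC : is_base_change (vinberg_str D) (rho_eval D) restr (in_alg C)) :
  exists B : {lrmorphism bernAlg E -> C},
    [/\ forall nu : 'cV[int]_n, B (ba_E E nu) = restr (vexp D nu (- antidom D nu)),
        forall B' : {linear bernAlg E -> C},
          (forall nu, B' (ba_E E nu) = restr (vexp D nu (- antidom D nu))) ->
          B' =1 B
      & bijective B].
Proof.
have [restrP univ] := hC; have basis := ba_E_basis E.
have [B0 B0E] := basis_linear (fun nu => restr (vexp D nu (- antidom D nu))) basis.
have B0EM x y : B0 (ba_E E x * ba_E E y) = B0 (ba_E E x) * B0 (ba_E E y).
  rewrite ba_E_mul (linearZ_LR B0).
  by rewrite (B0E (x + y)) (B0E x) (B0E y) (restr_vexp_antidom_mul restrP).
have B0M : monoid_morphism B0.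
  split; first by rewrite -ba_E0 B0E antidom0 oppr0 [vexp D 0 0]mse0 rmorph1.
  move=> g h; have [[s [c ->]] [t [d ->]]] := (basis.2 g, basis.2 h).
  rewrite mulr_suml !linear_sum mulr_suml; apply: eq_bigr => x _.
  rewrite mulr_sumr !linear_sum mulr_sumr; apply: eq_bigr => y _.
  rewrite -scalerAl -scalerAr !(linearZ_LR B0).
  by rewrite B0EM -[RHS]scalerAl -[in RHS]scalerAr.
have [B BE] := linear_lrmorphism B0M.
have {BE}B0E nu : B (ba_E E nu) = restr (vexp D nu (- antidom D nu)) by rewrite BE.
exists B; split=> [//|B' B'E|].
  by apply: (basis_linear_ext basis) => nu; rewrite B'E [RHS]B0E.
(* h is the candidate inverse; kuniq says that an endomorphism of C fixing the
   images of restr and of Z[q] is determined. *)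
have [h [hr hs _]] := univ _ _ _ (vinberg_bern_str E).
have [k [_ _ kuniq]] := univ _ _ _ restrP.
have hlin : linear (h : C -> bernAlg E).
  by move=> a u v; rewrite rmorphD -mulr_algl rmorphM hs mulr_algl.
exists h.
  pose hmix := GRing.isLinear.Build _ _ _ _ (h : C -> bernAlg E) hlin.
  pose hL : {linear C -> bernAlg E} := HB.pack (h : C -> bernAlg E) hmix.
  apply: (basis_linear_ext (f := hL \o B) (g := idfun) basis) => nu /=.
  rewrite B0E [LHS]hr vinberg_bern_vexp ?addNr ?rpred0 //.
  by rewrite rho_ad0 expr0 scale1r.
(* Both B h and the identity fix restr and the structure map, so both are equal
   to the endomorphism k. *)
move=> z.
rewrite -[RHS](_ : (idfun : {rmorphism C -> C}) z = z) // (kuniq idfun) //.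
apply: (kuniq (B \o h)) => [a|a] /=.
  rewrite hr; apply: (monsubring_ext (f := B \o vinberg_bern E) (g := restr)).
  move=> [x y] xyP /=; rewrite vinberg_bern_vexp // (restr_vexp restrP) //.
  by rewrite linearZ_LR; congr (_ *: _); apply: B0E.
by rewrite hs rmorph_alg.
Qed.
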